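(* (i) For any value of the variance $v$ and any deviation level $\eta>0$, there is some probability distribution on $\mathbb{R}$ with variance $v$ and mean $0$ such that the i.i.d. sample $Y_1,\dots,Y_n$ of size $n$ drawn from it, with empirical mean $M=\frac1n\sum_{i=1}^nY_i$, satisfies $$\mathbb{P}(M\ge\eta)=\mathbb{P}(M\le-\eta)\ge\frac{v\left(1-\frac{v}{\eta^2n^2}\right)^{n-1}}{2n\eta^2}.$$ (ii) Thus, as soon as $\epsilon\le(2e)^{-1}$, there is some such distribution (with variance $v$ and mean $m=0$) for which, with probability at least $2\epsilon$, $$|M-m|\ge\sqrt{\frac{v}{2n\epsilon}}\left(1-\frac{2e\epsilon}{n}\right)^{\frac{n-1}{2}}.$$
   Context: Here $n$ is the sample size, $M$ is the empirical mean of the sample and $m$ is the mean of the sample distribution.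
   Formalization: Part (i) adds the hypothesis that the lower bound v(1−v/(η²n²))^{n−1}/(2nη²) is at most 1/2; otherwise it is false (e.g. n=1, v>η²), as the two tail events are disjoint with equal probability. This holds automatically if v≤η²n². *)

(* Defs.v *)
From HB Require Import structures.
From mathcomp Require Import all_boot all_order all_algebra.
From mathcomp Require Import all_classical all_reals all_analysis.

Set Implicit Arguments.
Unset Strict Implicit.
Unset Printing Implicit Defensive.

Import Order.TTheory GRing.Theory Num.Theory.
Import numFieldNormedType.Exports.

Local Open Scope classical_set_scope.
Local Open Scope ring_scope.

Definition law_mean (R : realType) (mu : probability (measurableTypeR R) R)
  : \bar R := ('E_mu[fun x : R => x])%E.

(* ['V_mu] is the expectation of the square of x - fine (law_mean mu); together
   with law_mean mu = 0, [law_variance mu = v%:E] therefore says that the second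
   moment of mu is finite and equal to v. *)
Definition law_variance (R : realType) (mu : probability (measurableTypeR R) R)
  : \bar R := ('V_mu[fun x : R => x])%E.

Definition mutually_independent (R : realType) (d : measure_display)
    (T : measurableType d) (P : probability T R) (n : nat)
    (Y : 'I_n -> {RV P >-> measurableTypeR R}) : Prop :=
  forall (J : {set 'I_n}) (B : 'I_n -> set (measurableTypeR R)),
    (forall i, measurable (B i)) ->
    P (\bigcap_(i in [set` J]) (Y i @^-1` B i))
    = (\prod_(i in J) P (Y i @^-1` B i))%E.

Definition iid_sample (R : realType) (mu : probability (measurableTypeR R) R)
    (d : measure_display) (T : measurableType d) (P : probability T R)
    (n : nat) (Y : 'I_n -> {RV P >-> measurableTypeR R}) : Prop :=
  mutually_independent Y /\
  forall (i : 'I_n) (B : set (measurableTypeR R)),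
    measurable B -> distribution P (Y i) B = mu B.

Definition empirical_mean (R : realType) (d : measure_display)
    (T : measurableType d) (P : probability T R) (n : nat)
    (Y : 'I_n -> {RV P >-> measurableTypeR R}) (w : T) : R :=
  n%:R^-1 * \sum_(i < n) (Y i w : R).

(* The two events {M >= eta} and {M <= - eta} are disjoint, so
   P(M >= eta) = P(M <= - eta) >= tail_bound n v eta can only hold if
   tail_bound n v eta <= 1/2, which is why the statement assumes it. The
   assumption is automatic when v <= eta^2 n^2 (tail_bound is then half the
   probability that a binomial variable with parameters (n, v / (eta^2 n^2))
   equals 1), and also when n is even; it fails for instance when n = 1 and
   eta^2 < v, where no law satisfies the inequality. *)
Definition tail_bound (R : realType) (n : nat) (v eta : R) : R :=
  v * (1 - v / (eta ^+ 2 * n%:R ^+ 2)) ^+ n.-1 / (2 * n%:R * eta ^+ 2).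

(* Main.v *)
Require Import Defs.
From HB Require Import structures.
From mathcomp Require Import all_boot all_order all_algebra.
From mathcomp Require Import all_classical all_reals all_analysis.
From mathcomp Require Import measurable_realfun ring lra.
Set Implicit Arguments.
Unset Strict Implicit.
Unset Printing Implicit Defensive.
Import Order.TTheory GRing.Theory Num.Theory.
Import numFieldNormedType.Exports.
Local Open Scope classical_set_scope.
Local Open Scope ring_scope.

(** The extremal laws are the symmetric laws with three atoms, giving mass
    [p / 2] to [- a] and to [a] and mass [1 - p] to [0]; such a law has mean 0
    and variance [p * a ^+ 2].  Write [q = v / (eta ^+ 2 * n ^+ 2)].

    If [q <= 1], take [a = n * eta] and [p = q].  A sample in which exactly one
    observation is [- a] and all the others vanish has empirical mean [- eta],
    and this happens with probability [n * (q / 2) * (1 - q) ^ (n - 1)], which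
    is [tail_bound n v eta] ([one_jump_tail], [small_variance_law]).

    If [q > 1], take [p = 1] and [a = Num.sqrt v], so that the sample is a
    simple random walk with steps [+a] and [-a].  For even [n] the bound is
    nonpositive.  For odd [n] the sum of [n] signs is odd, hence at least 1 in
    absolute value, so the empirical mean is at least [a / n > eta] in absolute
    value for every sample, and each tail has probability exactly 1/2
    ([sign_walk_tail], [large_variance_law]).

    The second part is the first one for the value of [eta] given by the
    threshold.  Put [b = 1 - 2 * e * eps / n].  From
    [(1 - 1 / n) ^ (n - 1) >= 1 / e] one gets [q <= 1 - b <= 1]; hence
    [(1 - q) ^ (n - 1) >= b ^ (n - 1)], and this is exactly what makes the sum
    of the two tail bounds at least [2 * eps] ([deviation_threshold]).

    All probabilities reduce to finite sums: a sample of a law carried by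
    finitely many atoms follows almost surely one of the finitely many patterns
    [f : {ffun 'I_n -> 'I_k}], the observation [i] being the atom of index
    [f i], and independence gives the pattern its product mass
    ([iid_finite_law]). *)

(** * Laws with finitely many atoms and their samples *)

(** The law is built as a sum of scaled Dirac masses.  The formula for
    expectations holds for functions of any sign because a finite sum of point
    evaluations is always finite, so that the positive and the negative parts
    can be recombined. *)
Lemma finite_law_exists (R : realType) (k : nat) (x w : nat -> R)
    (w0 : forall i, 0 <= w i) (w1 : \sum_(i < k) w i = 1) :
  exists mu : probability (measurableTypeR R) R,
    (forall A, mu A =
       \sum_(i < k) (w i)%:E * @dirac _ (measurableTypeR R) (x i) R A)%E /\
    (forall f : R -> R, measurable_fun setT f ->
       'E_mu[f] = (\sum_(i < k) w i * f (x i))%:E)%E.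
Proof.
pose m_ (i : nat) : {measure set (measurableTypeR R) -> \bar R} :=
  mscale (NngNum (w0 i)) (@dirac _ (measurableTypeR R) (x i) R).
pose m : {measure set (measurableTypeR R) -> \bar R} := msum m_ k.
have mT : m setT = 1%E.
  rewrite /m /= /msum /m_ /= /mscale /= -w1 -sumEFin.
  by apply: eq_bigr => i _; rewrite diracT mule1.
pose mu : probability (measurableTypeR R) R :=
  HB.pack (msum m_ k) (Measure_isProbability.Build _ _ _ (msum m_ k) mT).
have intE (f : measurableTypeR R -> \bar R) : (forall y, 0 <= f y)%E ->
    measurable_fun setT f ->
    (\int[mu]_y f y = \sum_(i < k) (w i)%:E * f (x i))%E.
  move=> f0 mf; rewrite [LHS]ge0_integral_measure_sum//; apply: eq_bigr => i _.
  by rewrite /m_ ge0_integral_mscale// integral_dirac// diracT mul1e.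
exists mu; split => // f mf.
have mEf : measurable_fun setT (fun y => (f y)%:E) by exact/measurable_EFinP.
rewrite unlock integralE /= !intE//; last 2 first.
- exact/measurable_funeneg.
- exact/measurable_funepos.
rewrite -sumEFin (eq_bigr (fun i : 'I_k => (w i * Num.max (f (x i)) 0)%:E)).
  rewrite [X in (_ - X)%E](eq_bigr (fun i : 'I_k => (w i * Num.max (- f (x i)) 0)%:E)).
    rewrite !sumEFin -EFinB -sumrB; congr EFin; apply: eq_bigr => i _.
    rewrite -mulrBr; congr (_ * _).
    by rewrite /Num.max; case: ifP; case: ifP; lra.
  by move=> i _; rewrite funenegE -EFinN -EFin_max EFinM.
by move=> i _; rewrite funeposE -EFin_max EFinM.
Qed.

(** The cells [C f], on which the observations follow the pattern [f], are
    disjoint because the atoms are distinct, and independence gives them the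
    masses of a product law, which sum to 1. *)
Lemma iid_finite_law (R : realType) (n k : nat) (x w : 'I_k -> R)
    (mu : probability (measurableTypeR R) R) (d : measure_display)
    (T : measurableType d) (P : probability T R)
    (Y : 'I_n -> {RV P >-> measurableTypeR R}) (Q : ('I_n -> R) -> bool) :
  injective x -> (forall j, mu [set x j] = (w j)%:E) -> \sum_j w j = 1 ->
  iid_sample mu Y -> measurable [set t | Q (fun i => Y i t)] ->
  P [set t | Q (fun i => Y i t)] =
    (\sum_(f : {ffun 'I_n -> 'I_k} | Q (fun i => x (f i)))
       \prod_i w (f i))%:E.
Proof.
move=> xI muw w1 [indY lawY] mQ.
pose C (f : {ffun 'I_n -> 'I_k}) : set T :=
  \bigcap_(i in [set` [set: 'I_n]%SET]) (Y i @^-1` [set x (f i)]).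
have mC f : measurable (C f).
  apply: fin_bigcap_measurable; first exact: finite_finset.
  by move=> i _; apply: measurable_sfunP.
have PC f : P (C f) = (\prod_i w (f i))%:E.
  rewrite /C indY; last by move=> i; exact: measurable_set1.
  rewrite -prodEFin; apply: eq_big => [i|i _]; first by rewrite inE.
  by rewrite -muw -(lawY i).
have CI f t : C f t -> forall i, Y i t = x (f i).
  by move=> Cft i; apply: Cft => /=; rewrite inE.
have tC : trivIset setT C.
  move=> f g _ _ [t [/CI tf /CI tg]]; apply/ffunP => i.
  by apply: xI; rewrite -tf tg.
have PU (B : {pred {ffun 'I_n -> 'I_k}}) :
  P (\bigcup_(f in [set` B]) C f) = (\sum_(f | B f) \prod_i w (f i))%:E.
  rewrite measure_fin_bigcup//; last exact: sub_trivIset tC.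
  rewrite -sumEFin [RHS]bigfs ?index_enum_uniq//.
    by apply: eq_fsbigr => f _; exact: PC.
  by move=> f _; rewrite mem_index_enum.
have mU (B : {pred {ffun 'I_n -> 'I_k}}) :
    measurable (\bigcup_(f in [set` B]) C f).
  by apply: fin_bigcup_measurable => //; exact: finite_finpred.
pose B (f : {ffun 'I_n -> 'I_k}) := Q (fun i => x (f i)).
have UQ (f : {ffun 'I_n -> 'I_k}) t : C f t ->
    Q (fun i => Y i t) = B f.
  by move=> /CI tf; congr Q; apply/funext.
(* The cells have total mass 1, so the lower bounds given by the cells inside
   the event and by those inside its complement are both equalities. *)
have : (P (\bigcup_(f in [set` B]) C f) <= P [set t | Q (fun i => Y i t)])%E.
  apply: le_measure; rewrite ?inE//.
  by move=> t [f /= Bf /UQ]; rewrite /= => ->.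
have : (P (\bigcup_(f in [set` predC B]) C f)
    <= P (~` [set t | Q (fun i => Y i t)]))%E.
  apply: le_measure; rewrite ?inE; [exact: mU|exact: measurableC|].
  by move=> t [f /= Bf /UQ]; rewrite /= => ->; exact/negP.
rewrite probability_setC// !PU.
have -> : P [set t | Q (fun i => Y i t)] =
    (fine (P [set t | Q (fun i => Y i t)]))%:E by rewrite fineK ?fin_num_measure.
have W1 : \sum_(f : {ffun 'I_n -> 'I_k}) \prod_i w (f i) = 1.
  rewrite -(bigA_distr_bigA (fun (_ : 'I_n) j => w j)) big1//.
rewrite -EFinB !lee_fin.
move: W1; rewrite (bigID B)/= => W1 le1 le2; congr EFin.
by apply/eqP; rewrite eq_le le2; lra.
Qed.

(** * The symmetric three-point laws *)

(** The indices 0, 1 and 2 stand for the atoms [- a], 0 and [a], so that the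
    reflection of the line acts on indices as [rev_ord]. *)
Definition atom (R : realType) (a : R) (j : nat) : R := a * (j%:R - 1).

Definition mass (R : realType) (p : R) (j : nat) : R :=
  if j == 1%N then 1 - p else p / 2.

Lemma mass_ge0 (R : realType) (p : R) (j : nat) :
  0 <= p <= 1 -> 0 <= mass p j.
Proof. by move=> p01; rewrite /mass; case: ifP => _; lra. Qed.

Lemma sum_mass (R : realType) (p : R) : \sum_(j < 3) mass p j = 1.
Proof. by rewrite !big_ord_recr big_ord0 /= /mass /=; lra. Qed.

Lemma atom_inj (R : realType) (a : R) :
  a != 0 -> injective (fun j : 'I_3 => atom a j).
Proof.
move=> a0 i j /(mulfI a0) /addIr /eqP; rewrite eqr_nat => /eqP ij.
exact: val_inj.
Qed.

Lemma atom_rev_ord (R : realType) (a : R) (j : 'I_3) :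
  atom a (rev_ord j) = - atom a j.
Proof. by rewrite /atom /= natrB// -natr1; ring. Qed.

Lemma mass_rev_ord (R : realType) (p : R) (j : 'I_3) :
  mass p (rev_ord j) = mass p j.
Proof. by rewrite /mass; case: j => -[|[|[|]]]. Qed.

Lemma three_point_law_exists (R : realType) (a p : R) :
  a != 0 -> 0 <= p <= 1 ->
  exists mu : probability (measurableTypeR R) R,
    [/\ law_variance mu = (p * a ^+ 2)%:E, law_mean mu = 0%:E &
      forall j : 'I_3, mu [set atom a j] = (mass p j)%:E].
Proof.
move=> a0 p01.
have [mu [muA muE]] := @finite_law_exists R 3 (atom a) (mass p)
  (fun j => mass_ge0 j p01) (sum_mass p).
have mean0 : law_mean mu = 0%:E.
  rewrite /law_mean muE//; congr EFin.
  by rewrite !big_ord_recr big_ord0 /= /mass /atom /=; field.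
exists mu; split => //.
  rewrite /law_variance /variance unlock.
  move: (mean0); rewrite /law_mean => ->/=; rewrite muE; last first.
    by apply: measurable_funM; apply: measurable_funB.
  congr EFin.
  by rewrite !big_ord_recr big_ord0 /= !mulrfctE /= /mass /atom /=; field.
move=> j; rewrite muA (bigD1 j)//= diracE mem_set// mule1 big1 ?adde0//.
move=> i ij; rewrite diracE memNset ?mule0// => /= /(atom_inj a0)/eqP.
by rewrite (negbTE ij).
Qed.

(** * Tails of the empirical mean as sums over patterns *)

Definition pattern_mean (R : realType) (n : nat) (a : R)
    (f : {ffun 'I_n -> 'I_3}) : R :=
  n%:R^-1 * \sum_(i < n) atom a (f i).

Definition pattern_prob (R : realType) (n : nat) (p : R)
    (f : {ffun 'I_n -> 'I_3}) : R :=
  \prod_(i < n) mass p (f i).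

(** Reflecting every observation preserves the mass of a pattern and changes
    the sign of its mean. *)
Lemma lower_upper_tail (R : realType) (n : nat) (a p eta : R) :
  \sum_(f : {ffun 'I_n -> 'I_3} | eta <= pattern_mean a f) pattern_prob p f =
  \sum_(f : {ffun 'I_n -> 'I_3} | pattern_mean a f <= - eta) pattern_prob p f.
Proof.
pose h (f : {ffun 'I_n -> 'I_3}) := [ffun i => rev_ord (f i)].
have hI : injective h.
  by apply: (can_inj (g := h)) => f; apply/ffunP => i; rewrite !ffunE rev_ordK.
rewrite (reindex_inj hI); apply: eq_big => f.
  rewrite /pattern_mean (eq_bigr (fun i => - atom a (f i))).
    by rewrite sumrN mulrN lerNr.
  by move=> i _; rewrite ffunE atom_rev_ord.
by move=> _; apply: eq_bigr => i _; rewrite ffunE mass_rev_ord.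
Qed.

Lemma pattern_prob_ge0 (R : realType) (n : nat) (p : R)
  (f : {ffun 'I_n -> 'I_3}) : 0 <= p <= 1 -> 0 <= pattern_prob p f.
Proof. by move=> p01; apply: prodr_ge0 => i _; exact: mass_ge0. Qed.

(** The patterns with one observation at [- n * eta] and all others at 0 have
    mean [- eta]; there are [n] of them, of equal mass. *)
Lemma one_jump_tail (R : realType) (n : nat) (p eta : R) :
  (0 < n)%N -> 0 <= p <= 1 ->
  n%:R * (p / 2) * (1 - p) ^+ n.-1 <=
  \sum_(f : {ffun 'I_n -> 'I_3} | pattern_mean (n%:R * eta) f <= - eta)
    pattern_prob p f.
Proof.
move=> n0 p01.
have nR : n%:R != 0 :> R by rewrite pnatr_eq0 -lt0n.
pose one_jump (j : 'I_n) : {ffun 'I_n -> 'I_3} :=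
  [ffun i => if i == j then ord0 else inord 1].
have jumpI : injective one_jump.
  move=> i j /ffunP /(_ i); rewrite !ffunE eqxx; case: eqP => // _ /(congr1 val).
  by rewrite /= inordK.
have jump_mean j : pattern_mean (n%:R * eta) (one_jump j) = - eta.
  rewrite /pattern_mean (bigD1 j)//= ffunE eqxx /atom sub0r big1.
    by rewrite addr0 mulrN1 mulrN mulKf.
  by move=> i /negbTE ij; rewrite ffunE ij inordK// subrr mulr0.
have jump_prob j : pattern_prob p (one_jump j) = p / 2 * (1 - p) ^+ n.-1.
  rewrite /pattern_prob (bigD1 j)//= ffunE eqxx; congr (_ * _).
  rewrite (eq_bigr (fun=> 1 - p)) ?prodr_const ?cardC1 ?card_ord//.
  by move=> i /negbTE ij; rewrite ffunE ij inordK.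
apply: (@le_trans _ _ (\sum_(f in [set one_jump j | j : 'I_n]%SET)
    pattern_prob p f)).
  rewrite big_imset /=; last by move=> i j _ _; exact: jumpI.
  rewrite (eq_bigr (fun=> p / 2 * (1 - p) ^+ n.-1)) => [|j _]; last exact: jump_prob.
  by rewrite sumr_const card_ord -[leRHS]mulr_natl [leRHS]mulrA.
rewrite big_mkcond [leRHS]big_mkcond; apply: ler_sum => f _.
case: ifPn => [/imsetP[j _ ->]|_]; first by rewrite jump_mean lexx.
by case: ifP => // _; exact: pattern_prob_ge0.
Qed.

(** For [p = 1] only the patterns of signs have positive mass.  A sum of an odd
    number of signs cannot vanish, so each such pattern falls in one of the two
    tails, which by symmetry share the total mass equally. *)
Lemma sign_walk_tail (R : realType) (n : nat) (a eta : R) :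
  odd n -> 0 < a -> n%:R * eta <= a ->
  2^-1 <= \sum_(f : {ffun 'I_n -> 'I_3} | pattern_mean a f <= - eta)
    pattern_prob (1 : R) f.
Proof.
move=> oddn a0 na.
have n0 : 0 < n%:R :> R by rewrite ltr0n odd_gt0.
have far (f : {ffun 'I_n -> 'I_3}) : pattern_prob (1 : R) f != 0 ->
    (eta <= pattern_mean a f) || (pattern_mean a f <= - eta).
  move=> Wf.
  have f1 i : f i != 1%N :> nat.
    apply: contraNneq Wf => fi; rewrite /pattern_prob (bigD1 i)//= /mass fi eqxx.
    by rewrite subrr mul0r.
  (* Indices 0 and 2 encode the signs, so the sum of the signs is the sum of
     the indices minus n; parity keeps it away from 0. *)
  pose N := (\sum_(i < n) f i)%N.
  have evenN : ~~ odd N.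
    rewrite /N; elim/big_ind : _ => // [x y|i _].
      by rewrite oddD; case: (odd x); case: (odd y).
    by move: (f1 i); case: (f i) => -[|[|[|]]].
  have -> : pattern_mean a f = n%:R^-1 * (a * (N%:R - n%:R)).
    rewrite /pattern_mean /atom -mulr_sumr sumrB natr_sum.
    by rewrite sumr_const card_ord.
  rewrite -(ler_pM2l n0) mulVKf ?gt_eqF// -[X in _ || X](ler_pM2l n0).
  rewrite mulVKf ?gt_eqF// mulrN.
  have [nN|Nn|Nn] := ltngtP n N; last by rewrite -Nn oddn in evenN.
  - have : 1 <= N%:R - n%:R :> R by rewrite lerBrDr nat1r ler_nat.
    by move=> ?; apply/orP; left; nra.
  - have : N%:R - n%:R <= - 1 :> R
      by rewrite lerBlDr addrC lerBrDr natr1 ler_nat.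
    by move=> ?; apply/orP; right; nra.
have : \sum_(f : {ffun 'I_n -> 'I_3}) pattern_prob (1 : R) f = 1.
  rewrite /pattern_prob -(bigA_distr_bigA (fun _ (j : 'I_3) => mass (1 : R) j)).
  by rewrite big1// => i _; exact: sum_mass.
have : \sum_(f : {ffun 'I_n -> 'I_3}) pattern_prob (1 : R) f <=
    \sum_(f : {ffun 'I_n -> 'I_3} | eta <= pattern_mean a f) pattern_prob (1 : R) f +
    \sum_(f : {ffun 'I_n -> 'I_3} | pattern_mean a f <= - eta) pattern_prob (1 : R) f.
  rewrite [X in _ <= X + _]big_mkcond [X in _ <= _ + X]big_mkcond -big_split /=.
  apply: ler_sum => f _; have [->|/far] := eqVneq (pattern_prob (1 : R) f) 0.
    by do 2 case: ifP => _; rewrite addr0.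
  have : 0 <= pattern_prob (1 : R) f by apply: pattern_prob_ge0; lra.
  by case: ifP; case: ifP => //=; lra.
rewrite lower_upper_tail; lra.
Qed.

(** * Laws with large tails *)

Lemma measurable_tails (R : realType) (n : nat) (d : measure_display)
    (T : measurableType d) (P : probability T R) (c : R)
    (Y : 'I_n -> {RV P >-> measurableTypeR R}) :
  measurable [set w | c <= empirical_mean Y w] /\
  measurable [set w | empirical_mean Y w <= c].
Proof.
have mM : measurable_fun setT (fun w => empirical_mean Y w).
  apply: measurable_funM => //; apply: measurable_sum => i.
  exact: (measurable_funPT (Y i)).
split.
  have -> : [set w | c <= empirical_mean Y w] =
      setT `&` (fun w => empirical_mean Y w) @^-1` `[c, +oo[%classic.
    by rewrite setTI; apply/seteqP; split => t; rewrite /= in_itv /= andbT.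
  exact: mM.
have -> : [set w | empirical_mean Y w <= c] =
    setT `&` (fun w => empirical_mean Y w) @^-1` `]-oo, c]%classic.
  by rewrite setTI; apply/seteqP; split => t; rewrite /= in_itv.
exact: mM.
Qed.

Lemma empirical_mean_tail (R : realType) (n : nat) (a p eta : R)
    (mu : probability (measurableTypeR R) R) (d : measure_display)
    (T : measurableType d) (P : probability T R)
    (Y : 'I_n -> {RV P >-> measurableTypeR R}) :
  a != 0 -> (forall j : 'I_3, mu [set atom a j] = (mass p j)%:E) ->
  iid_sample mu Y ->
  P [set w | eta <= empirical_mean Y w] =
    (\sum_(f : {ffun 'I_n -> 'I_3} | pattern_mean a f <= - eta)
       pattern_prob p f)%:E /\
  P [set w | empirical_mean Y w <= - eta] =
    (\sum_(f : {ffun 'I_n -> 'I_3} | pattern_mean a f <= - eta)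
       pattern_prob p f)%:E.
Proof.
move=> a0 muw iidY.
have [mU _] := measurable_tails eta Y.
have [_ mL] := measurable_tails (- eta) Y.
split.
  rewrite -lower_upper_tail.
  exact: (iid_finite_law (Q := fun y => eta <= n%:R^-1 * \sum_i y i)
    (atom_inj a0) muw (sum_mass p) iidY).
exact: (iid_finite_law (Q := fun y => n%:R^-1 * \sum_i y i <= - eta)
  (atom_inj a0) muw (sum_mass p) iidY).
Qed.

Definition tails_at_least (R : realType) (n : nat) (eta b : R)
    (mu : probability (measurableTypeR R) R) : Prop :=
  forall (d : measure_display) (T : measurableType d)
    (P : probability T R) (Y : 'I_n -> {RV P >-> measurableTypeR R}),
    iid_sample mu Y ->
    P [set w | eta <= empirical_mean Y w]
      = P [set w | empirical_mean Y w <= - eta] /\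
    (b%:E <= P [set w | (empirical_mean Y w <= - eta)%R])%E.

Lemma three_point_tails (R : realType) (n : nat) (a p eta b : R) :
  0 < a -> 0 <= p <= 1 ->
  b <= \sum_(f : {ffun 'I_n -> 'I_3} | pattern_mean a f <= - eta)
    pattern_prob p f ->
  exists mu : probability (measurableTypeR R) R,
    [/\ law_variance mu = (p * a ^+ 2)%:E, law_mean mu = 0%:E &
      tails_at_least n eta b mu].
Proof.
move=> a0 p01 ble; have an0 : a != 0 by rewrite gt_eqF.
have [mu [muv mum muw]] := three_point_law_exists an0 p01.
exists mu; split => // d T P Y iidY.
by have [-> ->] := empirical_mean_tail eta an0 muw iidY; rewrite lee_fin.
Qed.

(** The condition on [v] says that [p = v / (eta ^+ 2 * n ^+ 2)], the mass that
    jumps of size [n * eta] need for the variance to be [v], is at most 1. *)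
Lemma small_variance_law (R : realType) (n : nat) (v eta : R) :
  (0 < n)%N -> 0 <= v -> 0 < eta -> v <= eta ^+ 2 * n%:R ^+ 2 ->
  exists mu : probability (measurableTypeR R) R,
    [/\ law_variance mu = v%:E, law_mean mu = 0%:E &
      tails_at_least n eta (tail_bound n v eta) mu].
Proof.
move=> n0 v0 eta0 vle.
have nR : 0 < n%:R :> R by rewrite ltr0n.
have K0 : 0 < eta ^+ 2 * n%:R ^+ 2 by rewrite mulr_gt0// exprn_gt0.
pose p := v / (eta ^+ 2 * n%:R ^+ 2).
have p01 : 0 <= p <= 1 by rewrite divr_ge0 ?(ltW K0)//= ler_pdivrMr// mul1r.
have := one_jump_tail eta n0 p01.
have -> : n%:R * (p / 2) * (1 - p) ^+ n.-1 = tail_bound n v eta.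
  by rewrite /tail_bound -/p /p; field; rewrite !gt_eqF.
move=> /(three_point_tails (mulr_gt0 nR eta0) p01) [mu [muv mum mut]].
exists mu; split => //; rewrite muv /p; congr EFin.
by field; rewrite !gt_eqF.
Qed.

(** A three-point law with jumps of size [n * eta] cannot reach such a variance,
    and all the mass goes to [- Num.sqrt v] and [Num.sqrt v].  For odd [n] each
    tail has probability 1/2, the cap put on the bound; for even [n] the bound
    contains an odd power of [1 - v / (eta ^+ 2 * n ^+ 2) < 0] and is
    nonpositive. *)
Lemma large_variance_law (R : realType) (n : nat) (v eta : R) :
  (0 < n)%N -> 0 < eta -> eta ^+ 2 * n%:R ^+ 2 < v ->
  tail_bound n v eta <= 1 / 2 ->
  exists mu : probability (measurableTypeR R) R,
    [/\ law_variance mu = v%:E, law_mean mu = 0%:E &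
      tails_at_least n eta (tail_bound n v eta) mu].
Proof.
move=> n0 eta0 vgt ble.
have nR : 0 < n%:R :> R by rewrite ltr0n.
have K0 : 0 < eta ^+ 2 * n%:R ^+ 2 by rewrite mulr_gt0// exprn_gt0.
have v0 : 0 < v := lt_trans K0 vgt.
have p01 : 0 <= (1 : R) <= 1 by lra.
have s0 : 0 < Num.sqrt v by rewrite sqrtr_gt0.
have -> : v = 1 * Num.sqrt v ^+ 2 by rewrite mul1r sqr_sqrtr// ltW.
suff tail_le : tail_bound n v eta <=
    \sum_(f : {ffun 'I_n -> 'I_3} | pattern_mean (Num.sqrt v) f <= - eta)
      pattern_prob (1 : R) f.
  have [mu [muv mum mut]] := three_point_tails s0 p01 tail_le.
  exists mu; split => //; move: mut; rewrite mul1r sqr_sqrtr//; exact: ltW.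
have [oddn|evenn] := boolP (odd n).
  rewrite (le_trans ble)// div1r; apply: sign_walk_tail => //.
  rewrite -(@ler_pXn2r _ 2) ?nnegrE ?(ltW s0)//; last first.
    by rewrite mulr_ge0// ltW.
  by rewrite sqr_sqrtr ?(ltW v0)// exprMn mulrC ltW.
apply: (@le_trans _ _ 0); last first.
  by apply: sumr_ge0 => f _; exact: pattern_prob_ge0.
rewrite /tail_bound pmulr_lle0 ?invr_gt0 ?mulr_gt0 ?exprn_gt0//.
rewrite pmulr_rle0// exprn_odd_le0; last by rewrite -(prednK n0) /= negbK in evenn.
by rewrite subr_le0 ler_pdivlMr// mul1r ltW.
Qed.

(** With [k = n - 1], the inverse of [1 - 1 / n] is [1 + 1 / k], at most
    [expR (1 / k)].  For [n = 1] the power is the empty product, although its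
    base is 0. *)
Lemma expRN1_le (R : realType) (n : nat) :
  expR (- 1) <= (1 - n%:R^-1) ^+ n.-1 :> R.
Proof.
case: n => [|[|m]]; rewrite ?expr0 ?expR_le1 ?lerN10//.
set k : R := m.+1%:R; have k0 : 0 < k by rewrite ltr0n.
have -> : 1 - m.+2%:R^-1 = (1 + k^-1)^-1 :> R.
  by rewrite -natr1 -/k; field; rewrite !gt_eqF// addr_gt0.
rewrite exprVn expRN lef_pV2 ?posrE ?expR_gt0 ?exprn_gt0 ?addr_gt0 ?invr_gt0//.
have -> : expR 1 = expR k^-1 ^+ m.+1 :> R by rewrite -expRM_natl mulfV// gt_eqF.
apply: lerXn2r; rewrite ?nnegrE ?expR_ge0 ?expR_ge1Dx//.
by rewrite addr_ge0// invr_ge0 ltW.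
Qed.

(** * The deviation threshold *)

(** The two tails are disjoint because [eta] is positive. *)
Lemma two_sided_tail (R : realType) (n : nat) (eta b : R)
    (mu : probability (measurableTypeR R) R) (d : measure_display)
    (T : measurableType d) (P : probability T R)
    (Y : 'I_n -> {RV P >-> measurableTypeR R}) :
  0 < eta -> tails_at_least n eta b mu -> iid_sample mu Y ->
  ((2 * b)%:E <= P [set w | (eta <= `|empirical_mean Y w|)%R])%E.
Proof.
move=> eta0 mut iidY; have [sym ble] := mut _ _ _ _ iidY.
have [mU _] := measurable_tails eta Y.
have [_ mL] := measurable_tails (- eta) Y.
have -> : [set w | eta <= `|empirical_mean Y w|] =
    [set w | eta <= empirical_mean Y w] `|` [set w | empirical_mean Y w <= - eta].
  by apply/seteqP; split => w /=; rewrite ler_normr lerNr => /orP.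
rewrite measureU//; last first.
  by apply/seteqP; split => // w [/= h1 h2]; lra.
by rewrite mulr_natl mulr2n EFinD; apply: leeD => //; rewrite -sym in ble.
Qed.

(** Here [eta ^+ 2 = v / (2 * n * eps) * b ^ (n - 1)] with
    [b = 1 - 2 * e * eps / n], so the mass [q = v / (eta ^+ 2 * n ^+ 2)] of the
    jumps equals [2 * eps / (n * b ^ (n - 1))].  The hypothesis on [eps] gives
    [b >= 1 - 1 / n], hence [b ^ (n - 1) >= 1 / e] and [q <= 1 - b]; then
    [2 * tail_bound n v eta = 2 * eps * (1 - q) ^ (n - 1) / b ^ (n - 1)]
    is at least [2 * eps]. *)
Lemma deviation_threshold (R : realType) (n : nat) (v eps : R)
    (eta := Num.sqrt (v / (2 * n%:R * eps))
              * (1 - 2 * expR 1 * eps / n%:R) `^ ((n%:R - 1) / 2)) :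
  (0 < n)%N -> 0 < v -> 0 < eps -> eps <= (2 * expR 1)^-1 ->
  [/\ 0 < eta, v <= eta ^+ 2 * n%:R ^+ 2 &
      2 * eps <= 2 * tail_bound n v eta].
Proof.
move=> n0 v0 eps0 epsle.
have nR : 0 < n%:R :> R by rewrite ltr0n.
have n1 : 1 <= n%:R :> R by rewrite ler1n.
have e0 : 0 < expR 1 :> R := expR_gt0 1.
have c1 : 2 * expR 1 * eps <= 1 by rewrite mulrC -ler_pdivlMr ?div1r// mulr_gt0.
set b := 1 - 2 * expR 1 * eps / n%:R in eta *.
have bge : 1 - n%:R^-1 <= b by rewrite lerD2l lerN2 ler_piMl// invr_ge0 ltW.
have n1ge0 : 0 <= 1 - n%:R^-1 :> R by rewrite subr_ge0 invf_le1.
have b0 : 0 <= b := le_trans n1ge0 bge.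
set B := b ^+ n.-1.
have Bge : (expR 1)^-1 <= B.
  by rewrite -expRN (le_trans (expRN1_le _ n))// lerXn2r// nnegrE.
have B0 : 0 < B by rewrite (lt_le_trans _ Bge)// invr_gt0.
have eta2 : eta ^+ 2 = v / (2 * n%:R * eps) * B.
  rewrite /eta exprMn sqr_sqrtr; last by rewrite divr_ge0 ?mulr_ge0 ?ltW.
  congr (_ * _); rewrite -powR_mulrn ?powR_ge0// -powRrM mulfVK//.
  by rewrite -(prednK n0) -natr1 addrK powR_mulrn.
have eta_ge0 : 0 <= eta by rewrite mulr_ge0 ?sqrtr_ge0 ?powR_ge0.
have eta0 : 0 < eta.
  rewrite lt_def eta_ge0 andbT -sqrf_eq0 eta2 gt_eqF//.
  by rewrite mulr_gt0 ?divr_gt0 ?mulr_gt0.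
set q := v / (eta ^+ 2 * n%:R ^+ 2).
have qE : q = 2 * eps / (n%:R * B).
  by rewrite /q eta2; field; rewrite !gt_eqF.
have qle : q <= 1 - b.
  rewrite qE /b opprB addrCA subrr addr0.
  have -> : 2 * eps / (n%:R * B) = 2 * eps / n%:R * B^-1 by field; rewrite !gt_eqF.
  have -> : 2 * expR 1 * eps / n%:R = 2 * eps / n%:R * expR 1 by field; rewrite gt_eqF.
  rewrite ler_pM2l ?divr_gt0 ?mulr_gt0// -[leRHS]invrK lef_pV2 ?posrE ?invr_gt0//.
split => //.
  have : q <= 1 by lra.
  by rewrite /q ler_pdivrMr ?mul1r// mulr_gt0// exprn_gt0.
have -> : 2 * tail_bound n v eta = 2 * eps / B * (1 - q) ^+ n.-1.
  have -> : 2 * eps / B = n%:R * q by rewrite qE; field; rewrite !gt_eqF.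
  by rewrite /tail_bound -/q {2}/q; field; rewrite !gt_eqF.
rewrite mulrAC ler_pdivlMr// ler_pM2l ?mulr_gt0//.
by apply: lerXn2r; rewrite ?nnegrE; lra.
Qed.

Theorem proposition8p2 (R : realType) (n : nat) (v : R)
    (hn : (0 < n)%N) (hv : 0 <= v) :
  (forall eta : R, 0 < eta -> tail_bound n v eta <= 1 / 2 ->
    exists mu : probability (measurableTypeR R) R,
      [/\ law_variance mu = v%:E, law_mean mu = 0%:E &
        forall (d : measure_display) (T : measurableType d)
          (P : probability T R) (Y : 'I_n -> {RV P >-> measurableTypeR R}),
          iid_sample mu Y ->
          P [set w | eta <= empirical_mean Y w]
            = P [set w | empirical_mean Y w <= - eta] /\
          ((tail_bound n v eta)%:E
            <= P [set w | (empirical_mean Y w <= - eta)%R])%E])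
  /\
  (forall eps : R, 0 < eps -> eps <= (2 * expR 1)^-1 ->
    exists mu : probability (measurableTypeR R) R,
      [/\ law_variance mu = v%:E, law_mean mu = 0%:E &
        forall (d : measure_display) (T : measurableType d)
          (P : probability T R) (Y : 'I_n -> {RV P >-> measurableTypeR R}),
          iid_sample mu Y ->
          ((2 * eps)%:E
            <= P [set w |
                 (Num.sqrt (v / (2 * n%:R * eps))
                    * (1 - 2 * expR 1 * eps / n%:R) `^ ((n%:R - 1) / 2)
                  <= `|empirical_mean Y w - fine (law_mean mu)|)%R])%E]).
Proof.
split=> [eta eta0 ble|eps eps0 epsle].
  have [vle|vgt] := leP v (eta ^+ 2 * n%:R ^+ 2).
    exact: small_variance_law.
  exact: large_variance_law.
have := hv; rewrite le_eqVlt => /predU1P[v0|v0].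
  (* For v = 0 the threshold is 0, so any law of variance 0 will do. *)
  have [|mu [muv mum _]] := @small_variance_law R n v 1 hn hv ltr01.
    by rewrite -v0 mulr_ge0 ?exprn_ge0.
  exists mu; split => // d T P Y _.
  rewrite -v0 mul0r sqrtr0 mul0r.
  have -> : [set w | 0 <= `|empirical_mean Y w - fine (law_mean mu)|] = setT.
    by apply/seteqP; split => // w _ /=; exact: normr_ge0.
  rewrite probability_setT lee_fin.
  have e1 : 1 <= expR 1 :> R by rewrite -expR0 ler_expR.
  rewrite mulrC -ler_pdivlMr// div1r (le_trans epsle)//.
  by rewrite lef_pV2 ?posrE ?mulr_gt0 ?expR_gt0// ler_peMr.
have [eta0 vle epsb] := deviation_threshold hn v0 eps0 epsle.
have [mu [muv mum mut]] := small_variance_law hn hv eta0 vle.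
exists mu; split => // d T P Y iidY; rewrite mum /=.
under eq_set do rewrite subr0.
by apply: le_trans (two_sided_tail eta0 mut iidY); rewrite lee_fin.
Qed.
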